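(* Let $\ell=a_1|f_1|+\dots+a_m|f_m|$ be a positive linear combination of non-constant absolute polynomials on $\mathcal B^n$, i.e. $a_i>0$ real and $f_i\in K[x_1,\dots,x_n]$ non-constant, and denote the projective closure of the zero locus of $f_i$ by $V_i\subseteq\mathbb P^n$. Suppose $K$ is locally compact. Then $\ell$ has a global minimum in $\mathcal B^n$ if - the $V_i$ intersect in $K^n$, i.e. $V_1\cap\dots\cap V_m\cap K^n\ne\emptyset$; or - the $V_i$ never intersect, i.e. $V_1\cap\dots\cap V_m=\emptyset$. Moreover, any such global minimum can be attained on $K^n$ (the minimum value of $\ell$ on $\mathcal B^n$ is taken at a point of $K^n\subseteq\mathcal B^n$). In particular, if $(V_1\cap\dots\cap V_m)\setminus K^n=\emptyset$ then $\ell$ has a global minimum.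
   Context: $K$ is a field with a non-trivial valuation $\mathrm{val}\colon K\to\mathbb R\cup\{\infty\}$, complete with respect to the associated non-Archimedean absolute value $|a|=\exp(-\mathrm{val}(a))$. $\hat K$ is the completion of an algebraic closure of $K$, with the unique extension of $|\cdot|$. For $a\in K^n$, $r\in\mathbb R_{\ge0}^n$ put $B_{\mathcal B}(a,r)=\{z\in\hat K^n: |a_i-z_i|\le r_i\ \forall i\}$; $\mathcal B^n$ is the set of all of these polydiscs. $K^n$ is regarded as a subset of $\mathcal B^n$ via $a\mapsto B_{\mathcal B}(a,0)=\{a\}$. For $f\in K[x_1,\dots,x_n]$ and $B\in\mathcal B^n$, $|f|(B)=|f(B)|=\sup_{z\in B}|f(z)|$. A global minimum of $\ell$ in $\mathcal B^n$ is a $B\in\mathcal B^n$ with $\ell(B)=\inf_{B'\in\mathcal B^n}\ell(B')$. $\mathbb P^n=\mathbb P^n(K)$ contains $K^n$ as the standard affine chart via $(x_1,\dots,x_n)\mapsto[x_1:\dots:x_n:1]$, and $V_i\subseteq\mathbb P^n$ is the projective hypersurface cut out by the homogenisation of $f_i$ (with an extra variable). *)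

(* Defs.v *)
From HB Require Import structures.
(* This import must precede that of mathcomp-analysis: the levels of their
   notations are incompatible in the other order. *)
From mathcomp.multinomials Require Import mpoly.
From mathcomp Require Import all_boot all_order all_algebra.
From mathcomp Require Import all_classical all_reals all_analysis.

Set Implicit Arguments.
Unset Strict Implicit.
Unset Printing Implicit Defensive.

Import Order.TTheory GRing.Theory Num.Theory.

Local Open Scope classical_set_scope.
Local Open Scope ring_scope.

(* |x| = exp (- v x), with exp (-oo) = 0; [fine] loses nothing as v x != -oo. *)
Definition abs_of_valuation (R : realType) (T : Type) (v : T -> \bar R) (x : T)
  : R := fine (expeR (- v x)%E).

HB.mixin Record Field_isValued (R : realType) K of GRing.Field K := {
  valuation : K -> \bar R;
  valuation_gtNy : forall x, (-oo < valuation x)%E;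
  valuation_eqy : forall x, valuation x = +oo%E <-> x = 0;
  valuationM : forall x y,
    valuation (x * y)%R = (valuation x + valuation y)%E;
  valuationD : forall x y,
    (Order.min (valuation x) (valuation y) <= valuation (x + y)%R)%E;
  valuation_nontrivial : exists2 x, x != 0 & valuation x != 0%E
}.

#[short(type="valuedFieldType")]
HB.structure Definition ValuedField (R : realType) :=
  {K of GRing.Field K & Field_isValued R K}.

Definition absv (R : realType) (K : valuedFieldType R) (x : K) : R :=
  abs_of_valuation valuation x.

(* K with the metric |x - y|. This is an alias because in mathcomp-analysis a
   type with both a pseudometric and an addition is taken to carry a norm for
   which |x *+ n| = |x| *+ n. *)
Definition metric (R : realType) (K : valuedFieldType R) : Type := K.

Section Metric.
Context (R : realType) (K : valuedFieldType R).
Implicit Types x y z : K.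

Let ball x (e : R) y : Prop := absv (x - y) < e.

Lemma valuation1 : valuation (1 : K) = 0%E.
Proof.
have := valuationM (1 : K) 1; rewrite mulr1.
have := valuation_gtNy (1 : K).
case: (valuation 1) (valuation_eqy (1 : K)) => [r _ _ | h _ _ | //].
- move=> [] /eqP; rewrite -subr_eq0 opprD addrA subrr sub0r oppr_eq0.
  by move=> /eqP ->.
- by have /eqP := (proj1 h erefl); rewrite oner_eq0.
Qed.

Lemma valuationN x : valuation (- x) = valuation x.
Proof.
rewrite -mulN1r valuationM; suff -> : valuation (-1 : K) = 0%E by rewrite add0e.
have := valuationM (-1 : K) (-1); rewrite mulN1r opprK valuation1.
case: (valuation _) => [r [] /esym/eqP| |] //.
by rewrite -mulr2n mulrn_eq0 /= => /eqP ->.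
Qed.

Lemma absv0 : absv (0 : K) = 0.
Proof.
by rewrite /absv /abs_of_valuation (proj2 (valuation_eqy (0 : K)) erefl).
Qed.

Lemma absv_ge0 x : 0 <= absv x.
Proof. exact/fine_ge0/expeR_ge0. Qed.

Lemma absvN x : absv (- x) = absv x.
Proof. by rewrite /absv /abs_of_valuation valuationN. Qed.

Lemma absv_anti x y : (valuation x <= valuation y)%E -> absv y <= absv x.
Proof.
rewrite /absv /abs_of_valuation.
have := valuation_gtNy x; have := valuation_gtNy y.
case: (valuation x) => [r| |]; case: (valuation y) => [s| |] //= _ _.
by rewrite lee_fin ler_expR lerN2.
Qed.

Lemma absvD x y : absv (x + y) <= Num.max (absv x) (absv y).
Proof.
have := valuationD x y; rewrite ge_min le_max.
by case/orP => /absv_anti ->; rewrite ?orbT.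
Qed.

Lemma metric_center x (e : R) : 0 < e -> ball x e x.
Proof. by rewrite /ball subrr absv0. Qed.

Lemma metric_sym x y (e : R) : ball x e y -> ball y e x.
Proof. by rewrite /ball -absvN opprB. Qed.

Lemma metric_triangle x y z (e1 e2 : R) :
  ball x e1 y -> ball y e2 z -> ball x (e1 + e2) z.
Proof.
rewrite /ball => h1 h2; rewrite -(subrKA y).
apply: le_lt_trans (absvD _ _) _; rewrite gt_max.
have e1_gt0 := le_lt_trans (absv_ge0 _) h1.
have e2_gt0 := le_lt_trans (absv_ge0 _) h2.
apply/andP; split; first by apply: lt_trans h1 _; rewrite ltrDl.
by apply: lt_trans h2 _; rewrite ltrDr.
Qed.

HB.instance Definition _ := Choice.on (metric K).
HB.instance Definition _ := isPointed.Build (metric K) (0 : K).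
HB.instance Definition _ := hasNbhs.Build (metric K) (nbhs_ (entourage_ ball)).
HB.instance Definition _ := Nbhs_isPseudoMetric.Build R (metric K)
  erefl metric_center metric_sym metric_triangle erefl.

End Metric.

Definition complete_valued (R : realType) (K : valuedFieldType R) : Prop :=
  forall F : set_system (metric K), ProperFilter F -> cauchy F -> cvg F.

(* Khat is a completion of an algebraic closure Kbar of K, and iota is the
   composite embedding K -> Kbar -> Khat. The absolute value on Kbar is the one
   induced from Khat. *)
Definition completed_algebraic_closure (R : realType)
    (K Khat : valuedFieldType R) (iota : {rmorphism K -> Khat}) : Prop :=
  [/\ forall x : K, absv (iota x) = absv x,
      complete_valued Khat
    & exists (Kbar : closedFieldType)
             (j : {rmorphism K -> Kbar}) (c : {rmorphism Kbar -> Khat}),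
        [/\ forall y : Kbar, algebraicOver j y,
            forall x : K, iota x = c (j x)
          & dense (range c : set (metric Khat))]].

Section Polydiscs.
Context (R : realType) (K Khat : valuedFieldType R).
Variables (iota : {rmorphism K -> Khat}) (n : nat).

Definition polydisc (a : 'rV[K]_n) (r : 'I_n -> R) : set 'rV[Khat]_n :=
  [set z | forall i, absv (iota (a ord0 i) - z ord0 i) <= r i].

Definition polydiscs : set (set 'rV[Khat]_n) :=
  [set B | exists a r, (forall i, 0 <= r i) /\ B = polydisc a r].

Definition point_polydisc (a : 'rV[K]_n) : set 'rV[Khat]_n :=
  polydisc a (fun=> 0).

Definition abs_poly (f : {mpoly K[n]}) (B : set 'rV[Khat]_n) : R :=
  sup [set absv ((map_mpoly iota f).@[z ord0])
      | z in B].

Definition abs_comb (m : nat) (a : 'I_m -> R) (f : 'I_m -> {mpoly K[n]})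
    (B : set 'rV[Khat]_n) : R :=
  \sum_(i < m) a i * abs_poly (f i) B.

Definition global_minimum (l : set 'rV[Khat]_n -> R) (B : set 'rV[Khat]_n)
  : Prop := polydiscs B /\ l B = inf [set l B' | B' in polydiscs].

End Polydiscs.

Section ProjectiveSpace.
Variables (K : fieldType) (n : nat).

(* P^n(K) as the set of lines through the origin of K^(n+1). *)
Definition proj_space := {L : {vspace 'rV[K]_(n + 1)} | \dim L == 1%N}.

Definition homog_coords (x : 'rV[K]_n) : 'rV[K]_(n + 1) := row_mx x 1%:M.

Lemma homog_coords_dim (x : 'rV[K]_n) : \dim <[homog_coords x]>%VS == 1%N.
Proof.
rewrite dim_vline; suff -> : homog_coords x != 0 by [].
apply/eqP => /(congr1 rsubmx); rewrite row_mxKr linear0 => /matrixP/(_ 0 0).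
by rewrite !mxE => /eqP; rewrite oner_eq0.
Qed.

Definition affine_chart (x : 'rV[K]_n) : proj_space :=
  exist _ <[homog_coords x]>%VS (homog_coords_dim x).

(* The monomial x^e multiplied by the power of the extra variable, which is the
   last one, that brings its degree to d. *)
Definition homog_multinom (d : nat) (e : 'X_{1..n}) : 'X_{1..(n + 1)} :=
  [multinom match fintype.split i with
            | inl k => e k
            | inr _ => d - mdeg e
            end | i < n + 1].

(* [msize f] is 1 plus the total degree of f. *)
Definition homogenisation (f : {mpoly K[n]}) : {mpoly K[n + 1]} :=
  \sum_(e <- msupp f) f@_e *: 'X_[homog_multinom (msize f).-1 e].

Definition proj_hypersurface (f : {mpoly K[n]}) : set proj_space :=
  [set L : proj_space | forall v : 'rV[K]_(n + 1),
     v \in sval L -> (homogenisation f).@[v ord0] = 0].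

End ProjectiveSpace.

Arguments affine_chart {K n} x.

(* Main.v *)
(* A polydisc contains its centre, so l(B) is at least the value of l at the
   centre of B, and it suffices to minimise l(x) = sum_i a_i |f_i(x)| over K^n.
   If the V_i meet in K^n the minimum is 0. If they never meet, let F_i be the
   homogenisation of f_i and Phi = sum_i a_i |F_i|. Then Phi is continuous and
   positive on the compact set of the v in K^(n+1) with largest coordinate
   equal to 1, hence at least some c > 0 there. Writing (x, 1) = lambda v with
   v normalised in this way, |lambda| >= 1 and deg f_i >= 1 give
   l(x) >= c |lambda| >= c max_i |x_i|, so l is coercive on K^n and attains its
   minimum on a compact box. *)
Require Import Defs.
From HB Require Import structures.
From mathcomp.multinomials Require Import mpoly.
From mathcomp Require Import all_boot all_order all_algebra.
From mathcomp Require Import all_classical all_reals all_analysis.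
From mathcomp Require Import lra.

Set Implicit Arguments.
Unset Strict Implicit.
Unset Printing Implicit Defensive.

Import Order.TTheory GRing.Theory Num.Theory.
Import numFieldNormedType.Exports.

Local Open Scope classical_set_scope.
Local Open Scope ring_scope.

(** * The absolute value: multiplicativity, triangle inequalities, unboundedness *)

Section AbsoluteValue.
Context (R : realType) (K : valuedFieldType R).
Implicit Types x y : K.

Lemma absvM x y : absv (x * y) = absv x * absv y.
Proof.
rewrite /absv /abs_of_valuation valuationM.
have := valuation_gtNy x; have := valuation_gtNy y.
case: (valuation x) => [r| |]; case: (valuation y) => [s| |] //= _ _.
- by rewrite opprD expRD.
- by rewrite mulr0.
- by rewrite mul0r.
- by rewrite mul0r.
Qed.

Lemma absv1 : absv (1 : K) = 1.
Proof. by rewrite /absv /abs_of_valuation valuation1 /= oppr0 expR0. Qed.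

Lemma absv_eq0 x : (absv x == 0) = (x == 0).
Proof.
apply/eqP/eqP => [|->]; last exact: absv0.
rewrite /absv /abs_of_valuation => h; apply/valuation_eqy.
move: h (valuation_gtNy x); case: (valuation x) => [r| |] //= h _.
by have := expR_gt0 (- r); rewrite h ltxx.
Qed.

Lemma absvX x k : absv (x ^+ k) = absv x ^+ k.
Proof. by elim: k => [|k IH]; rewrite ?expr0 ?absv1// !exprS absvM IH. Qed.

Lemma absv_prod (I : Type) (s : seq I) (F : I -> K) :
  absv (\prod_(i <- s) F i) = \prod_(i <- s) absv (F i).
Proof. exact: (big_morph _ absvM absv1). Qed.

Lemma ler_absvD x y : absv (x + y) <= absv x + absv y.
Proof.
by apply: le_trans (absvD _ _) _; rewrite ge_max lerDl lerDr !absv_ge0.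
Qed.

Lemma ler_absv_sum (I : Type) (s : seq I) (F : I -> K) :
  absv (\sum_(i <- s) F i) <= \sum_(i <- s) absv (F i).
Proof.
elim/big_rec2: _ => [|i u v _ h]; first by rewrite absv0.
by apply: le_trans (ler_absvD _ _) _; rewrite lerD2l.
Qed.

Lemma ler_dist_absv x y : `|absv x - absv y| <= absv (x - y).
Proof.
have h (u w : K) : absv u - absv w <= absv (u - w).
  by rewrite lerBlDr -{1}[u](subrK w) ler_absvD.
have := h x y; have := h y x.
by rewrite -[absv (y - x)]absvN opprB ler_norml; lra.
Qed.

(** Non-triviality of the valuation gives a nonzero element with absolute value different from 1; it
    or its inverse exceeds 1, and its powers grow without bound by Bernoulli's inequality. *)
Lemma exists_absv_gt (t : R) : exists x : K, t < absv x.
Proof.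
have [x x1] : exists x : K, 1 < absv x.
  have [x x0 vx] := valuation_nontrivial (s := K).
  have ax0 : 0 < absv x by rewrite lt_neqAle absv_ge0 eq_sym absv_eq0 x0.
  have ax1 : absv x != 1.
    move: ax0 vx; rewrite /absv /abs_of_valuation.
    case: (valuation x) => [r| |] //=; rewrite ?ltxx// => _; rewrite -expR0.
    by apply: contraNneq => /expR_inj/eqP; rewrite oppr_eq0 => /eqP ->.
  case/lt_total/orP: ax1 => h; last by exists x.
  exists x^-1; rewrite -(ltr_pM2l ax0) -absvM mulfV// absv1 mulr1//.
have [k tk] : exists k : nat, t < absv x ^+ k.
  have bernoulli k : 1 + k%:R * (absv x - 1) <= absv x ^+ k.
    elim: k => [|k IH]; first by rewrite mul0r addr0.
    have : 0 <= k%:R * (absv x - 1) by rewrite mulr_ge0// subr_ge0 ltW.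
    by rewrite exprS -natr1; nra.
  have d0 : 0 < absv x - 1 by rewrite subr_gt0.
  exists (Num.bound `|t / (absv x - 1)|); apply: lt_le_trans (bernoulli _).
  rewrite ltr_pwDl// ltW// -ltr_pdivrMr//.
  by apply: le_lt_trans (ler_norm _) _; exact/archi_boundP/normr_ge0.
by exists (x ^+ k); rewrite absvX.
Qed.

End AbsoluteValue.

(** * Continuity of polynomials and compactness of balls *)

Section MetricTopology.
Context (R : realType) (K : valuedFieldType R).

Lemma continuous_metricP (T : topologicalType) (g : T -> metric K) :
  continuous g <->
  forall t (e : R), 0 < e -> \forall u \near t, absv ((g t : K) - g u) < e.
Proof.
split=> [cg t e e0|h t A /nbhs_ballP[e /= e0 eA]].
  apply: (cg t [set z | absv ((g t : K) - z) < e]).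
  by apply/nbhs_ballP; exists e.
by apply: filterS (h t e e0) => u /eA.
Qed.

Lemma continuous_metricD (T : topologicalType) (g h : T -> metric K) :
  continuous g -> continuous h ->
  continuous (fun t => (g t : K) + h t : metric K).
Proof.
move=> /continuous_metricP cg /continuous_metricP ch.
apply/continuous_metricP => t e e0.
apply: filterS2 (cg t e e0) (ch t e e0) => u gu hu.
by rewrite opprD addrACA (le_lt_trans (absvD _ _))// gt_max gu.
Qed.

Lemma continuous_metricM (T : topologicalType) (g h : T -> metric K) :
  continuous g -> continuous h ->
  continuous (fun t => (g t : K) * h t : metric K).
Proof.
move=> /continuous_metricP cg /continuous_metricP ch.
apply/continuous_metricP => t e e0.
have pos (x : K) : 0 < 1 + absv x by rewrite ltr_pwDl ?absv_ge0.
set b := 1 + absv (h t : K); set b' := 1 + absv (g t : K).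
have b0 : 0 < b by exact: pos.
have b'0 : 0 < b' by exact: pos.
(* The 1 forces [absv (h u) <= b]. As the ultrametric inequality takes a maximum, each of the two
   terms below may be as large as [e], with no halving. *)
have d0 : 0 < Num.min 1 (e / b') by rewrite lt_min ltr01 divr_gt0.
apply: filterS2 (cg t _ (divr_gt0 e0 b0)) (ch t _ d0) => u gu.
rewrite lt_min => /andP[hu1 hu].
have hub : absv (h u : K) <= b.
  rewrite -[h u : K](subrK (h t)) (le_trans (ler_absvD _ _))// lerD2r.
  by rewrite -absvN opprB ltW.
have -> : (g t : K) * h t - (g u : K) * h u =
    (g t : K) * ((h t : K) - h u) + ((g t : K) - g u) * h u.
  by rewrite mulrBr mulrBl addrA subrK.
apply: le_lt_trans (absvD _ _) _; rewrite gt_max !absvM; apply/andP; split.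
  rewrite ltr_pdivlMr// in hu; apply: le_lt_trans hu.
  by rewrite mulrC ler_wpM2l ?absv_ge0// lerDr.
rewrite ltr_pdivlMr// in gu; apply: le_lt_trans gu.
by rewrite ler_wpM2l ?absv_ge0.
Qed.

Lemma continuous_absv (T : topologicalType) (g : T -> metric K) :
  continuous g -> continuous (fun t => absv (g t : K) : R).
Proof.
move=> /continuous_metricP cg t; apply/cvgrPdist_lt => e e0.
by apply: filterS (cg t e e0) => u; exact/le_lt_trans/ler_dist_absv.
Qed.

Lemma continuous_coord n (i : 'I_n) :
  continuous (fun v : 'rV[metric K]_n => v ord0 i).
Proof.
move=> v A /nbhs_ballP[e e0 eA]; apply/nbhs_ballP; exists e => //= w [_ vw].
exact/eA/vw.
Qed.

Lemma continuous_metricX (T : topologicalType) (g : T -> metric K) k :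
  continuous g -> continuous (fun t => (g t : K) ^+ k : metric K).
Proof.
move=> cg; elim: k => [|k IH]; first exact: (@cst_continuous _ (metric K)).
rewrite (_ : (fun t => _) = (fun t => (g t : K) * g t ^+ k : metric K)).
  exact: continuous_metricM.
by apply/funext => t; rewrite exprS.
Qed.

Lemma continuous_meval n (p : {mpoly K[n]}) :
  continuous (fun v : 'rV[metric K]_n => p.@[(v : 'rV[K]_n) ord0] : metric K).
Proof.
rewrite (_ : (fun v => _) = (fun v : 'rV[metric K]_n =>
  \sum_(e <- msupp p) p@_e * \prod_i (v ord0 i : K) ^+ e i : metric K)) //.
apply: (@continuous_big (metric K) _ (@GRing.add K)) => [|e _].
  by apply: continuous_metricD => x; [exact: cvg_fst|exact: cvg_snd].
apply: continuous_metricM; first exact: (@cst_continuous _ (metric K)).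
apply: (@continuous_big (metric K) _ (@GRing.mul K)) => [|i _].
  by apply: continuous_metricM => x; [exact: cvg_fst|exact: cvg_snd].
exact/continuous_metricX/continuous_coord.
Qed.

(* Scaling by elements of large absolute value spreads a compact neighbourhood
   of 0 over any given ball. *)
Lemma compact_superset_ball (t : R) : locally_compact [set: metric K] ->
  exists2 C : set (metric K), compact C & forall x : K, absv x <= t -> C x.
Proof.
move=> /(_ (0 : K) I)[U /nbhs_ballP[e /= e0 eU] [cU _]].
have [c] := exists_absv_gt K (Num.max 0 (t / e)).
rewrite gt_max => /andP[c0 ct].
have c0' : c != 0 by rewrite -absv_eq0 gt_eqF.
exists ((fun x : metric K => c * (x : K) : metric K) @` U).
  apply: continuous_compact cU; apply: continuous_subspaceT.
  apply: continuous_metricM; first exact: (@cst_continuous _ (metric K)).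
  by move=> ?; exact: cvg_id.
move=> x xt; exists (c^-1 * x); last by rewrite mulVKf.
apply: eU => //; rewrite /ball /= sub0r absvN absvM.
rewrite -(ltr_pM2l c0) mulrA -absvM mulfV// absv1 mul1r.
by rewrite (le_lt_trans xt)// -ltr_pdivrMr.
Qed.

End MetricTopology.

(** * Homogenisation and projective hypersurfaces *)

Section Homogenisation.
Context (K : fieldType) (n : nat).
Implicit Types (p : {mpoly K[n]}) (v : 'rV[K]_(n + 1)) (x : 'rV[K]_n).

Lemma meval_homogenisation p v :
  (homogenisation p).@[v ord0] =
  \sum_(e <- msupp p) p@_e * ((\prod_i v ord0 (lshift 1 i) ^+ e i) *
    v ord0 (rshift n ord0) ^+ ((msize p).-1 - mdeg e)).
Proof.
rewrite /homogenisation raddf_sum; apply: eq_bigr => e _ /=.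
rewrite mevalZ mevalX big_split_ord big_ord1 /= mnmE (unsplitK (inr _)).
congr (_ * (_ * _)); apply: eq_bigr => i _.
by rewrite mnmE (unsplitK (inl _)).
Qed.

Lemma meval_homogenisationZ p v (c : K) :
  (homogenisation p).@[(c *: v) ord0] =
  c ^+ (msize p).-1 * (homogenisation p).@[v ord0].
Proof.
rewrite !meval_homogenisation mulr_sumr; apply: eq_big_seq => e ep.
rewrite mxE exprMn [RHS]mulrCA; congr (_ * _).
under eq_bigr do rewrite mxE exprMn.
rewrite big_split /= prodrXr -mdegE mulrACA -exprD subnKC//.
(* The truncated exponent [(msize p).-1 - mdeg e] is a true difference because [e] lies in the
   support of [p]. *)
by have := msize_mdeg_lt ep; case: (msize p).
Qed.

Lemma meval_homogenisation_chart p x :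
  (homogenisation p).@[homog_coords x ord0] = p.@[x ord0].
Proof.
rewrite meval_homogenisation mevalE; apply: eq_bigr => e _.
rewrite row_mxEr mxE expr1n mulr1; congr (_ * _).
by apply: eq_bigr => i _; rewrite row_mxEl.
Qed.

Lemma proj_hypersurface_chart p x :
  proj_hypersurface p (affine_chart x) <-> p.@[x ord0] = 0.
Proof.
rewrite -meval_homogenisation_chart; split=> [|px v /vlineP[c ->]].
  by apply; exact: memv_line.
by rewrite meval_homogenisationZ px mulr0.
Qed.

(** If all homogenisations vanished at [v], by homogeneity they would vanish on the whole line it
    spans, which would be a point of every hypersurface. *)
Lemma proj_hypersurfaces_eq0 (m : nat) (f : 'I_m -> {mpoly K[n]}) v :
  \bigcap_(i in [set: 'I_m]) proj_hypersurface (f i) = set0 -> v != 0 ->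
  exists i, (homogenisation (f i)).@[v ord0] != 0.
Proof.
move=> V0 v0; apply: contrapT => /forallNP h.
have dv : \dim <[v]>%VS == 1%N by rewrite dim_vline v0.
suff : set0 (exist _ <[v]>%VS dv : proj_space K n) by [].
rewrite -V0 => i _ _ /vlineP[c ->]; rewrite meval_homogenisationZ.
by have /negP/negPn/eqP -> := h i; rewrite mulr0.
Qed.

End Homogenisation.

(** * Absolute polynomials on polydiscs and reduction to their centres *)

Section AbsolutePolynomials.
Context (R : realType) (K Khat : valuedFieldType R).
Variables (iota : {rmorphism K -> Khat}) (n : nat).
Hypothesis absv_iota : forall x : K, absv (iota x) = absv x.
Implicit Types (p : {mpoly K[n]}) (x : 'rV[K]_n) (r : 'I_n -> R).

Lemma meval_map_mpoly p x :
  (map_mpoly iota p).@[map_mx iota x ord0] = iota p.@[x ord0].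
Proof.
rewrite !mevalE (perm_big _ (msupp_map_mpoly p (fmorph_inj iota))) rmorph_sum.
apply: eq_bigr => e _ /=; rewrite mcoeff_map_mpoly rmorphM rmorph_prod /=.
by congr (_ * _); apply: eq_bigr => i _; rewrite mxE rmorphXn.
Qed.

(** Ensures that the [sup] in [abs_poly] is a genuine supremum and not a default value. The bound is
    termwise, from |z_i| <= max(|x_i|, r_i) on the polydisc. *)
Lemma abs_poly_has_ubound p x r :
  has_ubound [set absv ((map_mpoly iota p).@[z ord0])
             | z in polydisc iota x r].
Proof.
exists (\sum_(e <- msupp (map_mpoly iota p)) absv (map_mpoly iota p)@_e *
  \prod_i Num.max (absv (x ord0 i)) (r i) ^+ e i).
move=> _ [z zB <-]; rewrite mevalE (le_trans (ler_absv_sum _ _))//.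
apply: ler_sum => e _; rewrite absvM ler_wpM2l ?absv_ge0// absv_prod.
apply: ler_prod => i _; rewrite absv_ge0 absvX /=.
rewrite lerXn2r ?nnegrE ?absv_ge0 ?le_max ?absv_ge0//.
rewrite -le_max -[z ord0 i](subKr (iota (x ord0 i))).
rewrite (le_trans (absvD _ _))// absvN absv_iota.
by rewrite ge_max le_max lexx/= le_max zB orbT.
Qed.

Lemma center_polydisc x r : (forall i, 0 <= r i) ->
  polydisc iota x r (map_mx iota x).
Proof. by move=> r0 i; rewrite mxE subrr absv0. Qed.

Lemma abs_poly_ge_center p x r : (forall i, 0 <= r i) ->
  absv p.@[x ord0] <= abs_poly iota p (polydisc iota x r).
Proof.
move=> r0; apply: ub_le_sup; first exact: abs_poly_has_ubound.
exists (map_mx iota x); first exact: center_polydisc.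
by rewrite meval_map_mpoly absv_iota.
Qed.

Lemma abs_poly_point p x :
  abs_poly iota p (point_polydisc iota x) = absv p.@[x ord0].
Proof.
have -> : point_polydisc iota x = [set map_mx iota x].
  apply/seteqP; split=> [z zx|_ ->]; last exact: center_polydisc.
  apply/rowP => i; rewrite mxE; apply/eqP; rewrite eq_sym -subr_eq0 -absv_eq0.
  by rewrite eq_le absv_ge0 zx.
by rewrite /abs_poly image_set1 sup1 meval_map_mpoly absv_iota.
Qed.

Section LinearCombination.
Variables (m : nat) (a : 'I_m -> R) (f : 'I_m -> {mpoly K[n]}).
Hypothesis a_gt0 : forall i, 0 < a i.

Lemma abs_comb_ge_center x r : (forall i, 0 <= r i) ->
  abs_comb iota a f (point_polydisc iota x) <=
  abs_comb iota a f (polydisc iota x r).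
Proof.
move=> r0; apply: ler_sum => i _.
by rewrite ler_wpM2l ?(ltW (a_gt0 i))// abs_poly_point abs_poly_ge_center.
Qed.

Lemma global_minimum_point x :
  (forall y, abs_comb iota a f (point_polydisc iota x) <=
             abs_comb iota a f (point_polydisc iota y)) ->
  global_minimum iota (abs_comb iota a f) (point_polydisc iota x).
Proof.
move=> xmin.
have pB : polydiscs iota (point_polydisc iota x) by exists x, (fun=> 0).
(* Used twice: to bound the infimum from below, and to show that the set has a lower bound, so that
   its [inf] is at most each of its elements. *)
have lbd : lbound [set abs_comb iota a f B' | B' in polydiscs iota (n := n)]
    (abs_comb iota a f (point_polydisc iota x)).
  move=> _ [_ [y [r [r0 ->]]] <-].
  exact: le_trans (xmin y) (abs_comb_ge_center _ r0).
split=> //; apply/eqP; rewrite eq_le lb_le_inf//=; last first.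
  by eexists; exists (point_polydisc iota x).
by apply: ge_inf; [eexists; exact: lbd|exists (point_polydisc iota x)].
Qed.

End LinearCombination.
End AbsolutePolynomials.

(** * Coercivity and existence of a minimum on affine space *)

Section Coercivity.
Context (R : realType) (K : valuedFieldType R) (n m : nat).
Variables (a : 'I_m -> R).
Hypothesis a_gt0 : forall i, 0 < a i.
Hypothesis hK : locally_compact [set: metric K].

(** The dimension [d] is free since this serves both the [f i] in [n] variables and their
    homogenisations in [n + 1]. *)
Definition point_comb d (f : 'I_m -> {mpoly K[d]}) (x : 'rV[K]_d) : R :=
  \sum_(i < m) a i * absv (f i).@[x ord0].

Lemma point_comb_ge0 d (f : 'I_m -> {mpoly K[d]}) x : 0 <= point_comb f x.
Proof.
by apply: sumr_ge0 => i _; rewrite mulr_ge0 ?absv_ge0// ltW.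
Qed.

Lemma continuous_point_comb d (f : 'I_m -> {mpoly K[d]}) :
  continuous (point_comb f : 'rV[metric K]_d -> R).
Proof.
apply: (@continuous_big R) => [x|i _].
  by apply: cvgD; [exact: cvg_fst|exact: cvg_snd].
move=> x; have /(_ x) := continuous_absv (@continuous_meval _ K d (f i)).
by move=> /continuous_comp; apply; exact: mulrl_continuous.
Qed.

(** Extreme value theorem on a product of compact sets. The factors may differ, so that one
    coordinate can be frozen at 1. *)
Lemma point_comb_box_min d (f : 'I_m -> {mpoly K[d]})
    (A : 'I_d -> set (metric K)) (x0 : 'rV[K]_d) :
  (forall i, compact (A i)) -> (forall i, A i (x0 ord0 i)) ->
  exists2 x : 'rV[K]_d, forall i, A i (x ord0 i) &
    forall y : 'rV[K]_d, (forall i, A i (y ord0 i)) ->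
      point_comb f x <= point_comb f y.
Proof.
move=> cA Ax0.
have A0 : [set v : 'rV[metric K]_d | forall i, A i (v ord0 i)] !=set0.
  by exists x0.
have cf := continuous_subspaceT (@continuous_point_comb d f).
have [x xA xmin] := compact_EVT_min A0 (rV_compact cA) (cf _).
exists x => [|y yA]; first by rewrite inE in xA.
by apply: xmin; rewrite inE.
Qed.

(** Divide by a coordinate [c] of largest absolute value; [absv c] is at least 1 because the last
    homogeneous coordinate is 1. *)
Lemma homog_coords_normalised (x : 'rV[K]_n) :
  exists (c : K) (v : 'rV[K]_(n + 1)) (j : 'I_(n + 1)),
    [/\ homog_coords x = c *: v, 1 <= absv c, v ord0 j = 1,
      forall i, absv (v ord0 i) <= 1 & forall i, absv (x ord0 i) <= absv c].
Proof.
set w := homog_coords x.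
case: (@arg_maxP _ R 'I_(n + 1) (rshift n ord0) predT
  (fun i => absv (w ord0 i)) isT) => j _ jmax.
have w1 : 1 <= absv (w ord0 j).
  have w_last : w ord0 (rshift n ord0) = 1 by rewrite row_mxEr mxE.
  by have := jmax (rshift n ord0) isT; rewrite w_last absv1.
have wj0 : w ord0 j != 0 by rewrite -absv_eq0 gt_eqF// (lt_le_trans ltr01).
exists (w ord0 j), ((w ord0 j)^-1 *: w), j; split=> //.
- by rewrite scalerA mulfV// scale1r.
- by rewrite mxE mulVf.
- move=> i; rewrite mxE -(ler_pM2l (lt_le_trans ltr01 w1)) -absvM mulVKf//.
  by rewrite mulr1; exact: jmax.
- by move=> i; have := jmax (lshift 1 i) isT; rewrite /w row_mxEl.
Qed.

Variable f : 'I_m -> {mpoly K[n]}.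
Hypothesis f_nonconstant : forall i (c : K), f i != c%:MP_[n].
Hypothesis V_eq0 :
  \bigcap_(i in [set: 'I_m]) proj_hypersurface (f i) = set0.

Let F i := homogenisation (f i).

Lemma homog_comb_lower_bound : exists2 c : R, 0 < c &
  forall (v : 'rV[K]_(n + 1)) (j : 'I_(n + 1)), v ord0 j = 1 ->
    (forall i, absv (v ord0 i) <= 1) -> c <= point_comb F v.
Proof.
have [C cC C1] := compact_superset_ball 1 hK.
have bnd (j : 'I_(n + 1)) : exists2 c : R, 0 < c & forall v : 'rV[K]_(n + 1),
    v ord0 j = 1 -> (forall i, absv (v ord0 i) <= 1) -> c <= point_comb F v.
  (* The normalised vectors are covered by [n + 1] compact boxes, one for each position [j] of the
     entry 1. [C] may exceed the unit ball, but the entry 1 alone keeps 0 out of the box, which is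
     all that positivity requires. *)
  pose A i : set (metric K) := if i == j then [set (1 : K)] else C.
  have [||u uA umin] := @point_comb_box_min _ F A (const_mx 1).
  - by move=> i; rewrite /A; case: ifP => _ //; exact: compact_set1.
  - by move=> i; rewrite /A mxE; case: ifP => _ //; apply: C1; rewrite absv1.
  exists (point_comb F u) => [|v vj v1]; last first.
    apply: umin => i; rewrite /A; case: eqP => [->|_] //; exact/C1/v1.
  have u0 : u != 0.
    apply/eqP => u0; have := uA j.
    by rewrite /A eqxx u0 mxE => /esym/eqP; rewrite oner_eq0.
  have [i Fi0] := proj_hypersurfaces_eq0 V_eq0 u0.
  rewrite lt_neqAle point_comb_ge0 andbT eq_sym psumr_neq0; last first.
    by move=> k _; rewrite mulr_ge0 ?absv_ge0// ltW.
  apply/hasP; exists i; rewrite ?mem_index_enum//=.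
  by rewrite mulr_gt0// lt_neqAle absv_ge0 eq_sym absv_eq0 Fi0.
(* The least of the finitely many bounds [c j] works for all positions at once. *)
have [c c0 cb] := fin_all_exists2 bnd.
case: (@arg_minP _ R 'I_(n + 1) (rshift n ord0) predT c isT) => j _ jmin.
exists (c j) => // v k vk v1.
by apply: le_trans (cb k v vk v1); exact: jmin.
Qed.

Lemma point_comb_coercive : exists2 c : R, 0 < c &
  forall (x : 'rV[K]_n) i, c * absv (x ord0 i) <= point_comb f x.
Proof.
have [c c0 cb] := homog_comb_lower_bound.
exists c => // x i.
have [l [v [j [xv l1 vj v1 xl]]]] := homog_coords_normalised x.
have cl := cb v j vj v1; rewrite -(ler_pM2r (lt_le_trans ltr01 l1)) in cl.
apply: (@le_trans _ _ (c * absv l)); first by rewrite ler_wpM2l// ltW.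
apply: le_trans cl _; rewrite mulr_suml; apply: ler_sum => k _.
rewrite -mulrA ler_wpM2l ?(ltW (a_gt0 k))//.
rewrite -(meval_homogenisation_chart _ x) xv meval_homogenisationZ.
rewrite absvM mulrC absvX ler_wpM2r ?absv_ge0//.
(* As [absv l] is at least 1, it is at most its power of exponent [(msize (f k)).-1]; that exponent
   is positive, since otherwise [f k] would be constant. *)
rewrite -[leLHS]expr1 ler_weXn2l// ltn_predRL ltnNge.
by apply: contra (f_nonconstant k (f k)@_0) => /msize1_polyC {1}->.
Qed.

Lemma point_comb_min : exists x, forall y, point_comb f x <= point_comb f y.
Proof.
have [c c0 cb] := point_comb_coercive.
(* The radius is chosen so that, by coercivity, a point with a coordinate outside [C] has value at
   least that at 0, while 0 itself lies in the box. *)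
have [C cC Ct] := compact_superset_ball (point_comb f 0 / c) hK.
have C0 : C (0 : K).
  by apply: Ct; rewrite absv0 divr_ge0 ?point_comb_ge0// ltW.
have [||x _ xmin] := @point_comb_box_min _ f (fun=> C) 0 => //.
  by move=> i; rewrite mxE.
exists x => y.
have [yC|/existsNP[i yi]] := pselect (forall i, C (y ord0 i)).
  exact: xmin.
apply: le_trans (xmin 0 _) _; first by move=> k; rewrite mxE.
apply: le_trans (cb y i); rewrite mulrC -ler_pdivrMr//.
by rewrite leNgt; apply/negP => /ltW/Ct.
Qed.

End Coercivity.

(** * The theorem on global minima *)

Theorem theorem52 (R : realType) (K Khat : valuedFieldType R)
    (hcK : complete_valued K)
    (iota : {rmorphism K -> Khat})
    (hiota : completed_algebraic_closure iota)
    (n m : nat) (a : 'I_m -> R) (f : 'I_m -> {mpoly K[n]})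
    (ha : forall i, 0 < a i)
    (hf : forall (i : 'I_m) (c : K), f i != c%:MP_[n])
    (hK : locally_compact [set: metric K]) :
  let l := abs_comb iota a f in
  let V := \bigcap_(i in [set: 'I_m]) proj_hypersurface (f i) in
  (V `&` range affine_chart !=set0 \/ V = set0 ->
     (exists B, global_minimum iota l B) /\
     (forall B, global_minimum iota l B ->
        exists x : 'rV[K]_n, l (point_polydisc iota x) = l B)) /\
  (V `\` range affine_chart = set0 -> exists B, global_minimum iota l B).
Proof.
move=> l V; have [absv_iota _ _] := hiota.
have lE x : l (point_polydisc iota x) = point_comb a f x.
  by apply: eq_bigr => i _; rewrite abs_poly_point.
have attained : V `&` range affine_chart !=set0 \/ V = set0 ->
    exists x, global_minimum iota l (point_polydisc iota x).
  move=> hV; suff [x xmin] : exists x, forall y,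
      point_comb a f x <= point_comb a f y.
    by exists x; apply: global_minimum_point => // y; rewrite -/l !lE.
  case: hV => [[L [VL [x _ xL]]]|V0]; last exact: point_comb_min.
  (* At a common affine zero every term is 0, the least possible value. *)
  exists x => y; rewrite [leLHS]big1 ?point_comb_ge0// => i _.
  have /proj_hypersurface_chart -> : proj_hypersurface (f i) (affine_chart x).
    by rewrite xL; exact: VL.
  by rewrite absv0 mulr0.
split=> [/attained[x xmin]|VA].
  split; first by exists (point_polydisc iota x).
  (* All global minima share the value of the infimum, so one point attaining it serves for every
     [B]. *)
  by move=> B [_ lB]; exists x; rewrite lB; case: xmin.
suff /attained[x xmin] : V `&` range affine_chart !=set0 \/ V = set0.
  by exists (point_polydisc iota x).
have [->|/set0P[L VL]] := eqVneq V set0; [by right|left].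
exists L; split=> //; apply: contrapT => nL.
by have : (V `\` range affine_chart) L by []; rewrite VA.
Qed.
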